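(* Let $q\in\kappa$ be generic for $\Gamma$ and let $\Psi=(\bar V_i,A^i_j)$ be an $H$-representation of type $(\Gamma;q)$. Let $V$ and $t_i\in GL(V)$ $(i\in I)$ be the space and automorphisms constructed from $\Psi$ as in the context. Then the correspondence $\sigma_i\mapsto t_i$ $(i\in I)$ extends to a representation $\rho_\Psi$ of the Hecke algebra $H_q(\Gamma)$ on $V$.
   Context: $I$ is a finite set, $\Gamma=[m_{i,j}]_{i,j\in I}$ a Coxeter matrix ($m_{i,i}=1$, $m_{i,j}=m_{j,i}\ge2$ finite integers for $i\ne j$), $\kappa$ a field; spaces are finite dimensional. The numbers $4\cos^2(a\pi/m)$, $m=m_{i,j}$, are regarded as elements of $\kappa$ (i.e. $2+\zeta^a+\zeta^{-a}$ with $\zeta$ a primitive $m$-th root of unity). $H_q(\Gamma)$ is the $\kappa$-algebra generated by $\sigma_i$ ($i\in I$) with relations $\sigma_i\sigma_j\cdots=\sigma_j\sigma_i\cdots$ ($m_{i,j}$ alternating factors on each side) for $i\neq j$, and $(\sigma_i-q)(\sigma_i+1)=0$. $q\in\kappa\setminus\{0\}$ is generic if the dihedral Hecke algebra $H_q(I_{m_{i,j}})$ (two generators, off-diagonal entry $m_{i,j}$) is semisimple for all $i\ne j$. Put $\lambda_{m;q}(a)=4\cos^2(a\pi/m)\frac{1}{q+q^{-1}+2}$. $(m;q)$-couple: for linear $f:V\to W$, $g:W\to V$, $(f,g)$ is an $(m;q)$-couple between $V$ and $W$ if $gf$, $fg$ are diagonalizable with eigenvalues in $\{1\}\cup\{\lambda_{m;q}(a):1\le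 a\le[\frac{m-1}{2}]\}$ when $m$ is odd; for $m$ even the eigenvalue $0$ is also allowed, and then it is required that $gf(x)=0\Rightarrow f(x)=0$ and $fg(y)=0\Rightarrow g(y)=0$. $H$-representation of type $(\Gamma;q)$: spaces $\bar V_i$ ($i\in I$) and linear maps $A^i_j:\bar V_i\to\bar V_j$ ($i\ne j$) such that, with $\bar V_{i,j}=\ker(A^j_iA^i_j-\mathrm{id})\subset\bar V_i$: (a) $(A^i_j,A^j_i)$ is an $(m_{i,j};q)$-couple between $\bar V_i$ and $\bar V_j$ for all $i\ne j$; (b) $A^i_k(x)=A^j_kA^i_j(x)$ for distinct $i,j,k$ and $x\in\bar V_{i,j}$; (c) $\mathrm{Im}(A^k_j-A^i_jA^k_i)\subset\mathrm{Im}(\mathrm{id}_{\bar V_j}-A^i_jA^j_i)$ for distinct $i,j,k$. Construction: let $\bar V=\bigoplus_{i\in I}\bar V_i$, and for $i\in I$ let $\bar V_i^0\subset\bar V$ be the span of all $x-A^j_i(x)$ with $j\ne i$, $x\in\bar V_j$. Let $W\subset\bar V$ be the span of all $x-A^j_i(x)$ with $i\ne j$, $x\in\bar V_{j,i}$. Let $V=\bar V/W$, and let $V_i,V_i^0\subset V$ be the images of $\bar V_i,\bar V_i^0$. One has $V=V_i\oplus V_i^0$; $t_i\in GL(V)$ acts as $q$ on $V_i$ and as $-1$ on $V_i^0$. *)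

(* Defs.v *)
From HB Require Import structures.
From mathcomp Require Import all_boot all_algebra separable cyclotomic.
From mathcomp Require Import generic_quotient ring_quotient boolp.
From mathcomp.multinomials Require Import monalg.
Set Implicit Arguments.
Unset Strict Implicit.
Unset Printing Implicit Defensive.
Import GRing.Theory.
Local Open Scope ring_scope.
Local Open Scope quotient_scope.

Section DirectSum.
Import VectorInternalTheory.
Variables (K : fieldType) (I : finType) (V : I -> vectType K).

Definition dsum : Type := {dffun forall i, V i}.
HB.instance Definition _ := Choice.on dsum.
Implicit Types u v w : dsum.

Definition dsum_zero : dsum := [ffun i => 0].
Definition dsum_opp u : dsum := [ffun i => - u i].
Definition dsum_add u v : dsum := [ffun i => u i + v i].
Definition dsum_scale (a : K) u : dsum := [ffun i => a *: u i].

Fact dsum_addA : associative dsum_add.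
Proof. by move=> u v w; apply/ffunP=> i; rewrite !ffunE addrA. Qed.
Fact dsum_addC : commutative dsum_add.
Proof. by move=> u v; apply/ffunP=> i; rewrite !ffunE addrC. Qed.
Fact dsum_add0 : left_id dsum_zero dsum_add.
Proof. by move=> u; apply/ffunP=> i; rewrite !ffunE add0r. Qed.
Fact dsum_addN : left_inverse dsum_zero dsum_opp dsum_add.
Proof. by move=> u; apply/ffunP=> i; rewrite !ffunE addNr. Qed.
HB.instance Definition _ :=
  GRing.isZmodule.Build dsum dsum_addA dsum_addC dsum_add0 dsum_addN.

Fact dsum_scaleA a b u : dsum_scale a (dsum_scale b u) = dsum_scale (a * b) u.
Proof. by apply/ffunP=> i; rewrite !ffunE scalerA. Qed.
Fact dsum_scale1 : left_id 1 dsum_scale.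
Proof. by move=> u; apply/ffunP=> i; rewrite !ffunE scale1r. Qed.
Fact dsum_scaleDr : right_distributive dsum_scale +%R.
Proof. by move=> a u v; apply/ffunP=> i; rewrite !ffunE scalerDr. Qed.
Fact dsum_scaleDl u : {morph dsum_scale^~ u : a b / a + b}.
Proof. by move=> a b; apply/ffunP=> i; rewrite !ffunE scalerDl. Qed.
HB.instance Definition _ := GRing.Zmodule_isLmodule.Build K dsum
  dsum_scaleA dsum_scale1 dsum_scaleDr dsum_scaleDl.

Lemma dsum0E i : (0 : dsum) i = 0. Proof. by rewrite ffunE. Qed.
Lemma dsumDE u v i : (u + v) i = u i + v i. Proof. by rewrite ffunE. Qed.
Lemma dsumNE u i : (- u) i = - u i. Proof. by rewrite ffunE. Qed.
Lemma dsumZE a u i : (a *: u) i = a *: u i. Proof. by rewrite ffunE. Qed.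

Fact dsum_vect_iso :
  Vector.axiom (\sum_(j < #|I|) dim (V (enum_val j))) dsum.
Proof.
pose fr (u : dsum) : 'rV_(\sum_(j < #|I|) dim (V (enum_val j))) :=
  \mxrow_j v2r (u (enum_val j)).
exists fr.
  by move=> a u v; apply/rowP=> j; rewrite !mxE dsumDE dsumZE linearP !mxE.
pose G (r : 'rV_(\sum_(j < #|I|) dim (V (enum_val j)))) j :=
  r2v (submxrow r j) : V (enum_val j).
pose g r : dsum := [ffun i => ecast x (V x) (enum_rankK i) (G r (enum_rank i))].
have gE r j : g r (enum_val j) = G r j.
  rewrite ffunE; move: (enum_rankK (enum_val j)).
  by rewrite enum_valK => e; rewrite eq_axiomK.
exists g => [u|r].
  apply/ffunP=> i; rewrite -(enum_rankK i) gE /G mxrowK.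
  exact: v2rK.
apply/mxrowP=> j; rewrite mxrowK gE; exact: r2vK.
Qed.
HB.instance Definition _ := Lmodule_hasFinDim.Build K dsum dsum_vect_iso.

Definition dsum_in_fun i (x : V i) : dsum :=
  [ffun j => dfwith (fun k => 0 : V k) x j].

Fact dsum_in_fun_linear i : linear (@dsum_in_fun i).
Proof.
move=> a x y; apply/ffunP=> j; rewrite !ffunE.
case: (eqVneq i j) => [<-|nij]; first by rewrite !dfwith_in.
by rewrite !dfwith_out // scaler0 addr0.
Qed.
HB.instance Definition _ i := GRing.isLinear.Build K (V i) dsum _
  (@dsum_in_fun i) (@dsum_in_fun_linear i).

Definition dsum_in i : 'Hom(V i, dsum) := linfun (@dsum_in_fun i).

Lemma dsum_in_id i x : dsum_in i x i = x.
Proof. by rewrite lfunE ffunE dfwith_in. Qed.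
Lemma dsum_in_neq i j x : i != j -> dsum_in i x j = 0.
Proof. by move=> nij; rewrite lfunE ffunE dfwith_out. Qed.

Lemma dsum_sumE u : u = \sum_i dsum_in i (u i).
Proof.
apply/ffunP=> j.
have sumE (r : seq I) (F : I -> dsum) : (\sum_(i <- r) F i) j = \sum_(i <- r) F i j.
  by elim: r => [|i r IH]; rewrite ?big_nil ?big_cons ?dsum0E // dsumDE IH.
rewrite sumE (bigD1 j) //= dsum_in_id big1 ?addr0 // => i ij.
by rewrite dsum_in_neq.
Qed.

End DirectSum.

Section VectorQuotient.
Import VectorInternalTheory.
Variables (K : fieldType) (V : vectType K) (U : {vspace V}).

Definition vquot : Type := Quotient.quot (pred_of_vspace U : zmodClosed V).
HB.instance Definition _ := ZmodQuotient.on vquot.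
HB.instance Definition _ := Choice.on vquot.

Lemma vquot_eq (x y : V) : (\pi_vquot x == \pi_vquot y) = (x - y \in U).
Proof. by rewrite -Quotient.idealrBE. Qed.

Lemma vquot_repr (x : V) : repr (\pi_vquot x) - x \in U.
Proof. by rewrite -vquot_eq reprK. Qed.

Definition vquot_scale (a : K) (x : vquot) : vquot := \pi_vquot (a *: repr x).

Lemma vquot_scale_pi a (x : V) : vquot_scale a (\pi_vquot x) = \pi_vquot (a *: x).
Proof. by apply/eqP; rewrite vquot_eq -scalerBr rpredZ // vquot_repr. Qed.

Fact vquot_scaleA a b x : vquot_scale a (vquot_scale b x) = vquot_scale (a * b) x.
Proof. by rewrite -[x]reprK (vquot_scale_pi b) !vquot_scale_pi scalerA. Qed.
Fact vquot_scale1 : left_id 1 vquot_scale.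
Proof. by move=> x; rewrite -[x]reprK vquot_scale_pi scale1r. Qed.
Fact vquot_scaleDr : right_distributive vquot_scale +%R.
Proof.
move=> a x y; rewrite -[x]reprK -[y]reprK -raddfD !vquot_scale_pi.
by rewrite -raddfD scalerDr.
Qed.
Fact vquot_scaleDl x : {morph vquot_scale^~ x : a b / a + b}.
Proof.
by move=> a b; rewrite -[x]reprK !vquot_scale_pi -raddfD scalerDl.
Qed.
HB.instance Definition _ := GRing.Zmodule_isLmodule.Build K vquot
  vquot_scaleA vquot_scale1 vquot_scaleDr vquot_scaleDl.

Definition vquot_pi_fun (x : V) : vquot := \pi_vquot x.
Fact vquot_pi_fun_linear : linear vquot_pi_fun.
Proof.
move=> a x y; rewrite /vquot_pi_fun raddfD; congr (_ + _).
by rewrite -[RHS]/(vquot_scale _ _) vquot_scale_pi.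
Qed.
HB.instance Definition _ :=
  GRing.isLinear.Build K V vquot _ vquot_pi_fun vquot_pi_fun_linear.

Fact vquot_vect_iso : Vector.axiom (dim (subvs_of U^C)) vquot.
Proof.
pose p := daddv_pi U^C U.
have dU : (U^C :&: U = 0)%VS by rewrite capvC capv_compl.
have pD x : x = p x + daddv_pi U U^C x.
  by rewrite daddv_pi_add // addvC addv_complf memvf.
have pB x : x - p x \in U by rewrite {1}[x]pD addrAC subrr add0r memv_pi.
have p0 x : x \in U -> p x = 0.
  move=> Ux; apply/eqP; rewrite -memv0 -dU memv_cap memv_pi /=.
  by rewrite -[p x](subKr x) rpredB ?pB.
have pE x y : x - y \in U -> p x = p y.
  by move/p0/eqP; rewrite linearB subr_eq0 => /eqP.
pose f (x : vquot) := v2r (vsproj U^C (p (repr x))).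
exists f.
  move=> a x y; rewrite -linearP -linearP -linearP /f.
  congr (v2r (vsproj _ _)); apply: pE.
  by rewrite -vquot_eq reprK [X in _ == X]vquot_pi_fun_linear /vquot_pi_fun !reprK.
exists (fun r => vquot_pi_fun (vsval (r2v r))) => [x|r].
  rewrite /f v2rK vsprojK ?memv_pi // -[RHS]reprK.
  by apply/eqP; rewrite vquot_eq -opprB rpredN pB.
rewrite /f; set y := r2v r.
rewrite (pE _ (vsval y)) ?vquot_repr // [p _]daddv_pi_id ?subvsP // vsvalK.
exact: r2vK.
Qed.
HB.instance Definition _ := Lmodule_hasFinDim.Build K vquot vquot_vect_iso.

Definition vquot_pi : 'Hom(V, vquot) := linfun vquot_pi_fun.

Lemma vquot_piP (x : V) : (vquot_pi x == 0) = (x \in U).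
Proof. by rewrite lfunE /= -(linear0 vquot_pi_fun) vquot_eq subr0. Qed.

Lemma lker_vquot_pi : lker vquot_pi = U.
Proof. by apply/vspaceP=> x; rewrite memv_ker vquot_piP. Qed.

Lemma limg_vquot_pi : limg vquot_pi = fullv.
Proof.
apply/vspaceP=> y; rewrite memvf; apply/memv_imgP.
by exists (repr y); rewrite ?memvf // lfunE /= /vquot_pi_fun reprK.
Qed.

End VectorQuotient.

Section Words.
Variables (R : pzSemiRingType).

(* x * y * x * ... with n factors *)
Fixpoint alternate (x y : R) (n : nat) : R :=
  if n is n'.+1 then x * alternate y x n' else 1.

End Words.

(* generic identities, stated apart because rewriting in {malg _} is slow *)
Fact sandwichD (R : nzRingType) (a b c d r z : R) :
  a * (c * r * d + z) * b = (a * c) * r * (d * b) + a * z * b.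
Proof. by rewrite mulrDr mulrDl !mulrA. Qed.

Fact mulrB_mixed (R : nzRingType) (x y x' y' : R) :
  x' * y' - x * y = x' * (y' - y) + (x' - x) * y.
Proof. by rewrite mulrBr mulrBl addrA subrK. Qed.

Fact malg_scalerAr (K : fieldType) (N : monomType) a (x y : {malg K[N]}) :
  a *: (x * y) = x * (a *: y).
Proof.
have comm : a%:MP * x = x * a%:MP.
  rewrite [LHS]malgM_def fgmulUg [RHS]malgM_def fgmulgU.
  by apply: eq_bigr => k _; rewrite mulrC mul1m mulm1.
by rewrite -(mul_malgC _ y) -mul_malgC [LHS]mulrA [RHS]mulrA comm.
Qed.

Section Hecke.
Variables (K : fieldType) (I : finType) (M : I -> I -> nat) (q : K).

Let F := {malg K[{fmonom I}]}.
Let X (i : I) : F := << fmu i >>.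

Inductive hecke_relator : F -> Prop :=
| HeckeQuadratic i : hecke_relator ((X i - q *: 1) * (X i + 1))
| HeckeBraid i j of i != j :
    hecke_relator (alternate (X i) (X j) (M i j) - alternate (X j) (X i) (M i j)).

(* the two-sided ideal generated by the relators *)
Inductive hecke_ideal : F -> Prop :=
| HeckeIdeal0 : hecke_ideal 0
| HeckeIdealD a r b x of hecke_relator r & hecke_ideal x :
    hecke_ideal (a * r * b + x).

Definition hecke_idealb : {pred F} := fun x => `[< hecke_ideal x >].

Lemma hecke_idealDr x y : hecke_ideal x -> hecke_ideal y -> hecke_ideal (x + y).
Proof.
move=> hx hy; elim: hx => [|a r b z hr _ IH]; first by rewrite add0r.
by rewrite -addrA; apply: HeckeIdealD.
Qed.

Lemma hecke_idealM a b x : hecke_ideal x -> hecke_ideal (a * x * b).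
Proof.
elim=> [|c r d z hr _ IH]; first by rewrite mulr0 mul0r; apply: HeckeIdeal0.
by rewrite sandwichD; apply: HeckeIdealD.
Qed.

Fact hecke_idealb_closed : zmod_closed hecke_idealb.
Proof.
split=> [|x y /asboolP hx /asboolP hy]; first by apply/asboolP/HeckeIdeal0.
apply/asboolP/hecke_idealDr => //.
by rewrite -[- y]mulr1 -mulN1r; apply: hecke_idealM.
Qed.
HB.instance Definition _ := GRing.isZmodClosed.Build F hecke_idealb
  hecke_idealb_closed.

Lemma hecke_idealMl a x : x \in hecke_idealb -> a * x \in hecke_idealb.
Proof. by move=> /asboolP hx; apply/asboolP; rewrite -[_ * _]mulr1; apply: hecke_idealM. Qed.
Lemma hecke_idealMr b x : x \in hecke_idealb -> x * b \in hecke_idealb.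
Proof. by move=> /asboolP hx; apply/asboolP; rewrite -[x]mul1r; apply: hecke_idealM. Qed.

Definition hecke_alg : Type := Quotient.quot (hecke_idealb : zmodClosed F).
HB.instance Definition _ := ZmodQuotient.on hecke_alg.
HB.instance Definition _ := Choice.on hecke_alg.

Definition hecke_pi (x : F) : hecke_alg := \pi_hecke_alg x.

Lemma hecke_pi_eq x y : (hecke_pi x == hecke_pi y) = (x - y \in hecke_idealb).
Proof. by rewrite /hecke_pi -Quotient.idealrBE. Qed.

Lemma hecke_pi_repr (x : hecke_alg) : hecke_pi (repr x) = x.
Proof. exact: reprK. Qed.

Lemma hecke_piD x y : hecke_pi (x + y) = hecke_pi x + hecke_pi y.
Proof. exact: raddfD. Qed.

Definition hecke_one : hecke_alg := hecke_pi 1.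
Definition hecke_mul (x y : hecke_alg) : hecke_alg := hecke_pi (repr x * repr y).
Definition hecke_scale (a : K) (x : hecke_alg) : hecke_alg := hecke_pi (a *: repr x).

Lemma hecke_repr_pi x : repr (hecke_pi x) - x \in hecke_idealb.
Proof. by rewrite -hecke_pi_eq hecke_pi_repr. Qed.

Lemma hecke_mul_pi x y : hecke_mul (hecke_pi x) (hecke_pi y) = hecke_pi (x * y).
Proof.
apply/eqP; rewrite hecke_pi_eq; set x' := repr _; set y' := repr _.
rewrite mulrB_mixed rpredD //.
  by rewrite hecke_idealMl // hecke_repr_pi.
by rewrite hecke_idealMr // hecke_repr_pi.
Qed.

Lemma hecke_scale_pi a x : hecke_scale a (hecke_pi x) = hecke_pi (a *: x).
Proof.
apply/eqP; rewrite hecke_pi_eq -scalerBr -mul_malgC.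
by rewrite hecke_idealMl // hecke_repr_pi.
Qed.

Lemma hecke_ind (P : hecke_alg -> Prop) : (forall x, P (hecke_pi x)) -> forall x, P x.
Proof. by move=> hP x; rewrite -(hecke_pi_repr x). Qed.

Fact hecke_mulA : associative hecke_mul.
Proof.
elim/hecke_ind=> x; elim/hecke_ind=> y; elim/hecke_ind=> z.
by rewrite (hecke_mul_pi y) (hecke_mul_pi x y) !hecke_mul_pi mulrA.
Qed.
Fact hecke_mul1l : left_id hecke_one hecke_mul.
Proof. by elim/hecke_ind=> x; rewrite hecke_mul_pi mul1r. Qed.
Fact hecke_mulr1 : right_id hecke_one hecke_mul.
Proof. by elim/hecke_ind=> x; rewrite hecke_mul_pi mulr1. Qed.
Fact hecke_mulDl : left_distributive hecke_mul +%R.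
Proof.
elim/hecke_ind=> x; elim/hecke_ind=> y; elim/hecke_ind=> z.
by rewrite -hecke_piD !hecke_mul_pi -hecke_piD mulrDl.
Qed.
Fact hecke_mulDr : right_distributive hecke_mul +%R.
Proof.
elim/hecke_ind=> x; elim/hecke_ind=> y; elim/hecke_ind=> z.
by rewrite -hecke_piD !hecke_mul_pi -hecke_piD mulrDr.
Qed.

(* [sigma_i |-> -1] is a one-dimensional representation, so the quotient is
   not the zero ring *)
Definition hecke_sgn (m : {fmonom I}) : K := (-1) ^+ size m.
Fact hecke_sgn_mmorphism : mmorphism hecke_sgn.
Proof.
split=> [x y|]; rewrite /hecke_sgn; last by rewrite fm1.
by rewrite fmM size_cat exprD.
Qed.
HB.instance Definition _ := isMultiplicative.Build {fmonom I} K hecke_sgn hecke_sgn_mmorphism.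

Fact hecke_one_neq0 : hecke_one != 0.
Proof.
rewrite -[0](raddf0 \pi_hecke_alg) hecke_pi_eq subr0; apply/asboolP => h1.
pose e (x : F) : K := mmap idfun hecke_sgn x.
have eD x y : e (x + y) = e x + e y by apply: raddfD.
have eM x y : e (x * y) = e x * e y by apply: rmorphM.
have eN x : e (- x) = - e x by apply: raddfN.
have e1 : e 1 = 1 by apply: rmorph1.
have eX i : e (X i) = -1 by rewrite /e mmapU mul1r /= /hecke_sgn fmuE.
have eA n i j : e (alternate (X i) (X j) n) = (-1) ^+ n.
  by elim: n i j => [|n IH] i j; rewrite /= ?e1 // eM eX IH exprS.
have : e 1 = 0.
  elim: h1 => [|a r b x hr _ IH]; first exact: raddf0.
  rewrite eD IH addr0 !eM; suff -> : e r = 0 by rewrite mulr0 mul0r.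
  case: hr => [i|i j _]; first by rewrite eM [X in _ * X]eD eX e1 addNr mulr0.
  by rewrite eD eN !eA subrr.
by rewrite e1 => /eqP; rewrite oner_eq0.
Qed.

HB.instance Definition _ := GRing.Zmodule_isNzRing.Build hecke_alg
  hecke_mulA hecke_mul1l hecke_mulr1 hecke_mulDl hecke_mulDr hecke_one_neq0.

Fact hecke_scaleA a b x : hecke_scale a (hecke_scale b x) = hecke_scale (a * b) x.
Proof.
by elim/hecke_ind: x => x; rewrite (hecke_scale_pi b) !hecke_scale_pi scalerA.
Qed.
Fact hecke_scale1 : left_id 1 hecke_scale.
Proof. by elim/hecke_ind=> x; rewrite hecke_scale_pi scale1r. Qed.
Fact hecke_scaleDr : right_distributive hecke_scale +%R.
Proof.
move=> a; elim/hecke_ind=> x; elim/hecke_ind=> y.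
by rewrite -hecke_piD !hecke_scale_pi -hecke_piD scalerDr.
Qed.
Fact hecke_scaleDl x : {morph hecke_scale^~ x : a b / a + b}.
Proof.
by elim/hecke_ind: x => x a b; rewrite !hecke_scale_pi -hecke_piD scalerDl.
Qed.
HB.instance Definition _ := GRing.Zmodule_isLmodule.Build K hecke_alg
  hecke_scaleA hecke_scale1 hecke_scaleDr hecke_scaleDl.

Fact hecke_scalerAl (a : K) (x y : hecke_alg) : a *: (x * y) = a *: x * y.
Proof.
elim/hecke_ind: x => x; elim/hecke_ind: y => y.
rewrite -[_ * _]/(hecke_mul _ _) -[RHS]/(hecke_mul _ _).
rewrite -[LHS]/(hecke_scale _ _) -[_ *: _]/(hecke_scale _ _).
by rewrite hecke_scale_pi !hecke_mul_pi hecke_scale_pi scalerAl.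
Qed.
HB.instance Definition _ :=
  GRing.Lmodule_isLalgebra.Build K hecke_alg hecke_scalerAl.

Fact hecke_scalerAr (a : K) (x y : hecke_alg) : a *: (x * y) = x * (a *: y).
Proof.
elim/hecke_ind: x => x; elim/hecke_ind: y => y.
rewrite -[_ * _]/(hecke_mul _ _) -[RHS]/(hecke_mul _ _).
rewrite -[LHS]/(hecke_scale _ _) -[_ *: _]/(hecke_scale _ _).
rewrite hecke_scale_pi !hecke_mul_pi hecke_scale_pi.
by rewrite malg_scalerAr.
Qed.
HB.instance Definition _ :=
  GRing.Lalgebra_isAlgebra.Build K hecke_alg hecke_scalerAr.

Definition hecke_gen (i : I) : hecke_alg := hecke_pi (X i).

Lemma hecke_piM x y : hecke_pi (x * y) = hecke_pi x * hecke_pi y.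
Proof. by rewrite -hecke_mul_pi. Qed.
Lemma hecke_piZ a x : hecke_pi (a *: x) = a *: hecke_pi x.
Proof. by rewrite -hecke_scale_pi. Qed.

Lemma hecke_pi_eq0 x : hecke_pi x = 0 <-> hecke_ideal x.
Proof.
have -> : 0 = hecke_pi 0 by rewrite /hecke_pi raddf0.
split=> [/eqP|h]; first by rewrite hecke_pi_eq subr0 => /asboolP.
by apply/eqP; rewrite hecke_pi_eq subr0; apply/asboolP.
Qed.

End Hecke.

Section SemisimpleAlgebra.
Variables (K : fieldType) (A : algType K).

Definition left_ideal (J : A -> Prop) : Prop :=
  [/\ J 0, forall x y, J x -> J y -> J (x + y) & forall a x, J x -> J (a * x)].

(* the regular module is semisimple: every submodule is a direct summand *)
Definition semisimple_alg : Prop :=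
  forall J : A -> Prop, left_ideal J ->
  exists J' : A -> Prop,
    [/\ left_ideal J', forall x, J x -> J' x -> x = 0
      & forall x, exists y z, [/\ J y, J' z & x = y + z]].

End SemisimpleAlgebra.

Definition coxeter_matrix (I : eqType) (M : I -> I -> nat) : Prop :=
  (forall i, M i i = 1%N) /\
  (forall i j, i != j -> M i j = M j i /\ (2 <= M i j)%N).

Definition dihedral_matrix (m : nat) (i j : bool) : nat := if i == j then 1%N else m.

Definition generic (K : fieldType) (I : finType) (M : I -> I -> nat) (q : K) : Prop :=
  q != 0 /\
  forall i j, i != j -> semisimple_alg (hecke_alg (dihedral_matrix (M i j)) q).

Definition representation (K : fieldType) (A : algType K) (V : vectType K)
    (rho : A -> 'End(V)) : Prop :=
  [/\ linear rho, rho 1 = \1%VF & forall x y, rho (x * y) = (rho x \o rho y)%VF].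

(* [fourcos2 m c]: [c a] is the number 4 cos^2(a pi / m) = 2 + z^a + z^-a of K,
   where z is a primitive m-th root of unity in an extension L of K. Being a
   root of the m-th cyclotomic polynomial is the same as being primitive if m is
   invertible in K (see [root_Cyclotomic_prim]), and is what reducing the
   algebraic integers 4 cos^2(a pi / m) to characteristic p means if p | m,
   e.g. for m = p = 2 or m = p = 3. *)
Definition fourcos2 (K : fieldType) (m : nat) (c : nat -> K) : Prop :=
  exists (L : fieldType) (iota : {rmorphism K -> L}) (z : L),
    root (map_poly intr 'Phi_m) z /\
    forall a, iota (c a) = 2%:R + z ^+ a + z ^- a.

Section CyclotomicRoots.
Variable L : fieldType.
Local Notation Phi d := (map_poly intr 'Phi_d : {poly L}).

Lemma prod_Phi n : (n > 0)%N -> \prod_(d <- divisors n) Phi d = 'X^n - 1.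
Proof.
move=> n0; rewrite -rmorph_prod prod_Cyclotomic // rmorphB rmorph1 /=.
by rewrite map_polyXn.
Qed.

Lemma root_Phi_expr1 d n (z : L) :
  (n > 0)%N -> (d %| n)%N -> root (Phi d) z -> z ^+ n = 1.
Proof.
move=> n0 dn zd; have : root ('X^n - 1 : {poly L}) z.
  rewrite -prod_Phi // (bigD1_seq d) ?divisors_uniq -?dvdn_divisors //=.
  by rewrite rootM zd.
by rewrite /root !hornerE subr_eq0 => /eqP.
Qed.

Lemma expr1_root_Phi n (z : L) :
  (n > 0)%N -> z ^+ n = 1 -> exists2 d, (d %| n)%N & root (Phi d) z.
Proof.
move=> n0 zn; have : root ('X^n - 1 : {poly L}) z.
  by rewrite /root !hornerE zn subrr.
rewrite -prod_Phi // -(big_map _ predT id) -[root _ _]negbK root_bigmul.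
rewrite all_map -has_predC => /hasP[d]; rewrite -dvdn_divisors //= negbK.
by exists d.
Qed.

Lemma prim_root_Cyclotomic m (z : L) : m.-primitive_root z -> root (Phi m) z.
Proof.
move=> zP; have m0 := prim_order_gt0 zP.
have [d dm zd] := expr1_root_Phi m0 (prim_expr_order zP).
suff <- : d = m by [].
apply/eqP; rewrite eqn_dvd dm (prim_order_dvd zP); apply/eqP.
by apply: root_Phi_expr1 zd; rewrite ?(dvdn_gt0 m0 dm).
Qed.

Lemma root_Cyclotomic_prim m (z : L) :
  m%:R != 0 :> L -> root (Phi m) z = m.-primitive_root z.
Proof.
move=> mL; have m0 : (m > 0)%N by case: (m) mL => //; rewrite eqxx.
apply/idP/idP=> [zm|]; last exact: prim_root_Cyclotomic.
have [d zd dm] := prim_order_exists m0 (root_Phi_expr1 m0 (dvdnn m) zm).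
have [<- // | ndm] := eqVneq d m.
have d0 := dvdn_gt0 m0 dm.
have [e ed ze] := expr1_root_Phi d0 (prim_expr_order zd).
have nem : e != m.
  by apply: contraNneq ndm => em; rewrite eqn_dvd dm -em.
have : separable.separable_poly ('X^m - 1 : {poly L}) by apply: separable_Xn_sub_1.
rewrite -prod_Phi // (bigD1_seq m) ?divisors_uniq -?dvdn_divisors //=.
rewrite separable_mul => /and3P[_ _ /coprimep_root/(_ zm)].
rewrite -big_filter (bigD1_seq e) ?filter_uniq ?divisors_uniq //=; last first.
  by rewrite mem_filter nem -dvdn_divisors // (dvdn_trans ed).
by rewrite hornerM (rootP ze) mul0r eqxx.
Qed.

End CyclotomicRoots.

Section Couples.
Variables (K : fieldType).

Definition lfun_diagonalizable (V : vectType K) (f : 'End(V)) : Prop :=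
  exists2 b : seq V, basis_of fullv b &
    forall v, v \in b -> exists a : K, f v = a *: v.

(* the argument c of [lambda] and below is meant to be as in [fourcos2] *)
Variables (q : K) (m : nat) (c : nat -> K).

Definition lambda (a : nat) : K := c a * (q + q^-1 + 2%:R)^-1.

Definition couple_eigenvalue (mu : K) : Prop :=
  [\/ mu = 1,
      exists a, (1 <= a <= (m - 1)./2)%N /\ mu = lambda a
    | ~~ odd m /\ mu = 0].

Definition couple (V W : vectType K) (f : 'Hom(V, W)) (g : 'Hom(W, V)) : Prop :=
  [/\ lfun_diagonalizable (g \o f)%VF /\ lfun_diagonalizable (f \o g)%VF,
      forall mu, passmx.leigenvalue (g \o f)%VF mu -> couple_eigenvalue mu,
      forall mu, passmx.leigenvalue (f \o g)%VF mu -> couple_eigenvalue mu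
    & ~~ odd m ->
      (forall x, g (f x) = 0 -> f x = 0) /\ (forall y, f (g y) = 0 -> g y = 0)].

End Couples.

(* the subspace \bar V_{i,j} of \bar V_i, for f = A^i_j and g = A^j_i *)
Definition fix_space (K : fieldType) (V W : vectType K)
    (f : 'Hom(V, W)) (g : 'Hom(W, V)) : {vspace V} :=
  lker ((g \o f) - \1)%VF.

(* [hrep_map i j] is A^i_j; its diagonal values [hrep_map i i] play no role. *)
Record hrep (K : fieldType) (I : finType) (M : I -> I -> nat) (q : K)
    (c : nat -> nat -> K) := HRep {
  hrep_space : I -> vectType K;
  hrep_map : forall i j, 'Hom(hrep_space i, hrep_space j);
  hrep_couple : forall i j, i != j ->
    couple q (M i j) (c (M i j)) (hrep_map i j) (hrep_map j i);
  hrep_trans : forall i j k, i != j -> j != k -> i != k ->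
    forall x, x \in fix_space (hrep_map i j) (hrep_map j i) ->
    hrep_map i k x = hrep_map j k (hrep_map i j x);
  hrep_img : forall i j k, i != j -> j != k -> i != k ->
    (limg (hrep_map k j - (hrep_map i j \o hrep_map k i))%VF
     <= limg (\1 - (hrep_map i j \o hrep_map j i))%VF)%VS
}.

Section Construction.
Variables (K : fieldType) (I : finType) (M : I -> I -> nat) (q : K).
Variables (c : nat -> nat -> K) (Psi : hrep M q c).

Local Notation A := (hrep_map Psi).

Definition hrep_bar : vectType K := dsum (hrep_space Psi).
Local Notation inb := (@dsum_in K I (hrep_space Psi)).

(* x |-> x - A^j_i x, from \bar V_j to \bar V *)
Definition hrep_diff j i : 'Hom(hrep_space Psi j, hrep_bar) :=
  (inb j - (inb i \o A j i))%VF.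

Definition hrep_bar0 i : {vspace hrep_bar} :=
  (\sum_(j | j != i) limg (hrep_diff j i))%VS.

Definition hrep_rel : {vspace hrep_bar} :=
  (\sum_i \sum_(j | j != i) hrep_diff j i @: fix_space (A j i) (A i j))%VS.

Definition hrep_V : vectType K := vquot hrep_rel.

Definition hrep_Vi i : {vspace hrep_V} := (vquot_pi hrep_rel @: limg (inb i))%VS.
Definition hrep_Vi0 i : {vspace hrep_V} := (vquot_pi hrep_rel @: hrep_bar0 i)%VS.

(* \bar V -> \bar V_i, the identity on \bar V_i and A^j_i on \bar V_j *)
Let proj i (u : hrep_bar) : hrep_space Psi i :=
  u i + \sum_(j | j != i) A j i (u j).

Fact hrep_proj_linear i : linear (proj i).
Proof.
move=> a u v; rewrite /proj dsumDE dsumZE scalerDr scaler_sumr addrACA -big_split.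
congr (_ + _); apply: eq_bigr => j _.
by rewrite dsumDE dsumZE linearP.
Qed.
HB.instance Definition _ i :=
  GRing.isLinear.Build K hrep_bar (hrep_space Psi i) _ (proj i) (hrep_proj_linear i).

Lemma hrep_proj_in i x : proj i (inb i x) = x.
Proof.
rewrite /proj dsum_in_id big1 ?addr0 // => j ji.
by rewrite dsum_in_neq 1?eq_sym // linear0.
Qed.

Lemma hrep_proj_in_neq i j x : j != i -> proj i (inb j x) = A j i x.
Proof.
move=> ji; rewrite /proj dsum_in_neq // add0r (bigD1 j) //= dsum_in_id.
by rewrite big1 ?addr0 // => k /andP[_ kj]; rewrite dsum_in_neq 1?eq_sym // linear0.
Qed.

Lemma hrep_diffE j i x : hrep_diff j i x = inb j x - inb i (A j i x).
Proof. by rewrite add_lfunE opp_lfunE comp_lfunE. Qed.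

Lemma hrep_proj_bar0 i u : u \in hrep_bar0 i -> proj i u = 0.
Proof.
move=> ui; have : (hrep_bar0 i <= lker (linfun (proj i)))%VS.
  apply/subv_sumP=> j ji; apply/subvP=> _ /memv_imgP[x _ ->].
  rewrite memv_ker lfunE /= hrep_diffE linearB /= hrep_proj_in hrep_proj_in_neq //.
  by rewrite subrr.
by move/subvP/(_ u ui); rewrite memv_ker lfunE => /eqP.
Qed.

Lemma hrep_decomp i u : u - inb i (proj i u) \in hrep_bar0 i.
Proof.
rewrite {1}[u]dsum_sumE /proj (bigD1 i) //= linearD linear_sum /= opprD addrACA.
rewrite subrr add0r -sumrB; apply: memv_suml => j ji.
rewrite -hrep_diffE; apply: subvP (memv_img _ (memvf _)).
exact: (sumv_sup j).
Qed.

Lemma hrep_rel_sub i : (hrep_rel <= hrep_bar0 i)%VS.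
Proof.
apply/subvP=> u hu; suff <- : u - inb i (proj i u) = u by apply: hrep_decomp.
suff: (hrep_rel <= lker (linfun (proj i)))%VS.
  by move/subvP/(_ u hu); rewrite memv_ker lfunE => /eqP /= ->; rewrite linear0 subr0.
apply/subv_sumP=> k _; apply/subv_sumP=> j jk.
apply/subvP=> _ /memv_imgP[x xjk ->].
rewrite memv_ker lfunE /= hrep_diffE linearB /=.
have [ki|ki] := eqVneq k i.
  by subst k; rewrite hrep_proj_in hrep_proj_in_neq // subrr.
have [ji|ji] := eqVneq j i.
  subst j; rewrite hrep_proj_in hrep_proj_in_neq //.
  move: xjk; rewrite memv_ker add_lfunE opp_lfunE comp_lfunE id_lfunE.
  by rewrite -oppr_eq0 opprB.
by rewrite !hrep_proj_in_neq // (hrep_trans jk ki ji xjk) subrr.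
Qed.

Lemma hrep_directP i : (hrep_Vi i :&: hrep_Vi0 i = 0)%VS.
Proof.
apply/eqP; rewrite -subv0; apply/subvP=> y; rewrite memv_cap => /andP[].
case/memv_imgP=> _ /memv_imgP[x _ ->] -> /memv_imgP[u ui].
move/eqP; rewrite -subr_eq0 -linearB vquot_piP => xu.
have : inb i x \in hrep_bar0 i.
  by rewrite -(subrK u (inb i x)) rpredD // (subvP (hrep_rel_sub i)).
by move/hrep_proj_bar0; rewrite hrep_proj_in => ->; rewrite !linear0 mem0v.
Qed.

Lemma hrep_addP i : (hrep_Vi i + hrep_Vi0 i = fullv)%VS.
Proof.
apply/vspaceP=> y; rewrite memvf; have : y \in limg (vquot_pi hrep_rel).
  by rewrite limg_vquot_pi memvf.
case/memv_imgP=> u _ ->; rewrite -(subrKC (inb i (proj i u)) u) linearD.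
by apply: memv_add; rewrite ?memv_img ?hrep_decomp ?memvf.
Qed.

(* t_i is well defined by [hrep_directP] and [hrep_addP] *)
Definition hrep_t i : 'End(hrep_V) :=
  (q *: daddv_pi (hrep_Vi i) (hrep_Vi0 i) - daddv_pi (hrep_Vi0 i) (hrep_Vi i))%VF.

Lemma hrep_t_Vi i x : x \in hrep_Vi i -> hrep_t i x = q *: x.
Proof.
move=> xi; have d := hrep_directP i.
have := @daddv_pi_add _ _ _ _ x d; rewrite hrep_addP memvf => /(_ isT).
rewrite add_lfunE opp_lfunE scale_lfunE daddv_pi_id // => /eqP.
by rewrite addrC -subr_eq0 addrK => /eqP ->; rewrite subr0.
Qed.

Lemma hrep_t_Vi0 i x : x \in hrep_Vi0 i -> hrep_t i x = - x.
Proof.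
move=> xi; have d : (hrep_Vi0 i :&: hrep_Vi i = 0)%VS by rewrite capvC hrep_directP.
have := @daddv_pi_add _ _ _ _ x d; rewrite addvC hrep_addP memvf => /(_ isT).
rewrite add_lfunE opp_lfunE scale_lfunE [daddv_pi (hrep_Vi0 i) _ x]daddv_pi_id //.
by move=> /eqP; rewrite addrC -subr_eq0 addrK => /eqP ->; rewrite scaler0 add0r.
Qed.

Lemma hrep_t_unit i : q != 0 -> lker (hrep_t i) == 0%VS.
Proof.
move=> q0; rewrite -subv0; apply/subvP=> x; rewrite memv_ker.
have : x \in (hrep_Vi i + hrep_Vi0 i)%VS by rewrite hrep_addP memvf.
case/memv_addP=> y yi [z zi ->]; rewrite linearD /= (hrep_t_Vi yi) (hrep_t_Vi0 zi).
rewrite subr_eq0 => /eqP yz.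
have z0 : z \in (hrep_Vi i :&: hrep_Vi0 i)%VS by rewrite memv_cap zi -yz rpredZ.
move: z0 yz; rewrite hrep_directP memv0 => /eqP -> /eqP.
by rewrite scaler_eq0 (negPf q0) /= => /eqP ->; rewrite addr0 mem0v.
Qed.

End Construction.

(* Main.v *)
From HB Require Import structures.
Require Import Defs.
From mathcomp Require Import all_boot all_algebra cyclotomic.
From mathcomp Require Import generic_quotient boolp ring.
From mathcomp.multinomials Require Import monalg.
Set Implicit Arguments.
Unset Strict Implicit.
Unset Printing Implicit Defensive.
Import GRing.Theory.
Local Open Scope ring_scope.

(* Write t_i = (q + 1) p_i - 1 with p_i the projection onto V_i along V_i^0.
   For i != j, condition (c) gives V = V_i + V_j + (V_i^0 :&: V_j^0), and both
   t_i and t_j act as -1 on the last summand. For an eigenvector x of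
   A^j_i A^i_j in V_i, the span of x and A^i_j x is stable under t_i and t_j:
   they act by q if the eigenvalue is 1, they commute on x if it is 0, and for
   the eigenvalue lambda(a) the product P = t_i t_j satisfies
   P^2 = q s P - q^2 with s = 4 cos^2(a pi / m) - 2. The powers of P are then
   given by Chebyshev polynomials in s, and the braid relation reduces to
   U_(m/2)(s) = 0 (m even) or U_((m+1)/2)(s) + U_((m-1)/2)(s) = 0 (m odd), in
   the indexing U_0 = 0, U_1 = 1. These are vanishing sums of powers of a root
   of the m-th cyclotomic polynomial, in every characteristic.
   If q = -1, all t_i are -1; so only q != 0 is used from genericity. *)

(** * Geometric sums at a root of a cyclotomic polynomial *)

Section CyclotomicSums.
Variable L : fieldType.
Local Notation Phi d := (map_poly intr 'Phi_d : {poly L}).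

(** The sum is the value at [z] of [('X^m - 1) / ('X^d - 1)], which [Phi m] divides because [m] does
    not divide [d]. Divisibility of polynomials replaces primitivity of [z], which may fail when the
    characteristic divides [m]. *)
Lemma root_Phi_geom d m (z : L) :
    (m > 0)%N -> (d %| m)%N -> d != m -> root (Phi m) z ->
  \sum_(j < m %/ d) (z ^+ d) ^+ j = 0.
Proof.
move=> m0 dm nd zm; have d0 := dvdn_gt0 m0 dm.
have Xd0 : 'X^d - 1 != 0 :> {poly L} by rewrite -size_poly_gt0 size_XnsubC.
pose S : {poly L} := \sum_(j < m %/ d) 'X^d ^+ j.
have E : 'X^m - 1 = ('X^d - 1) * S by rewrite -subrX1 -exprM mulnC divnK.
have : Phi m %| S.
  rewrite -(dvdp_mul2l _ _ Xd0) -E -!prod_Phi //.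
  (* The indices dividing [d] multiply to ['X^d - 1]; the others include [m]. *)
  rewrite [X in _ %| X](bigID (fun e => (e %| d)%N)) /=.
  apply: dvdp_mul.
    rewrite -[X in _ %| X]big_filter; set s := [seq _ <- _ | _].
    suff pe : perm_eq (divisors d) s by rewrite (perm_big _ pe) dvdpp.
    apply: uniq_perm; rewrite ?filter_uniq ?divisors_uniq // => e.
    rewrite mem_filter -!dvdn_divisors // andbC; apply/esym/andb_idl => ed.
    exact: dvdn_trans ed dm.
  rewrite -big_filter (bigD1_seq m) /= ?filter_uniq ?divisors_uniq //.
    by rewrite dvdp_mulr.
  rewrite mem_filter -dvdn_divisors // dvdnn andbT.
  by apply: contra nd => md; rewrite eqn_dvd dm.
case/dvdpP=> r rE; have := congr1 (horner^~ z) rE.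
rewrite /= hornerM (rootP zm) mulr0 /S horner_sum; apply: etrans.
by apply: eq_bigr => j _; rewrite !hornerE.
Qed.

(* If [z ^+ b = 1] although [m] does not divide [b], the characteristic of [L]
   divides the number of terms. *)
Lemma root_Phi_sum m b n (z : L) :
    (m > 0)%N -> (m %| b * n)%N -> ~~ (m %| b)%N -> root (Phi m) z ->
  \sum_(j < n) (z ^+ b) ^+ j = 0.
Proof.
move=> m0 mbn nmb zm; have z1 := root_Phi_expr1 m0 (dvdnn m) zm.
have [zb1|zb1] := eqVneq (z ^+ b) 1; last first.
  apply: (@mulfI _ (z ^+ b - 1)); first by rewrite subr_eq0.
  by rewrite mulr0 -subrX1 -exprM -(divnK mbn) mulnC exprM z1 expr1n subrr.
have d0 : (0 < gcdn m b)%N by rewrite gcdn_gt0 m0.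
have zd1 : z ^+ gcdn m b = 1.
  have [u v uv _] := egcdnP b m0.
  have : z ^+ (u * m) = z ^+ (v * b + gcdn m b) by rewrite uv.
  by rewrite exprD ![(_ * m)%N]mulnC ![(_ * b)%N]mulnC !exprM z1 zb1 !expr1n mul1r.
have nd : gcdn m b != m by apply: contra nmb => /eqP {1}<-; apply: dvdn_gcdr.
(* All terms of this sum are 1, so [m %/ gcdn m b] is zero in [L]; it divides [n]. *)
have := root_Phi_geom m0 (dvdn_gcdl m b) nd zm.
rewrite zd1 zb1; under eq_bigr do rewrite expr1n.
rewrite sumr_const card_ord => md0; under eq_bigr do rewrite expr1n.
rewrite sumr_const card_ord.
have /dvdnP[e ->] : (m %/ gcdn m b %| n)%N.
  rewrite -(dvdn_pmul2r d0) divnK ?dvdn_gcdl //.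
  by rewrite muln_gcdr dvdn_gcd dvdn_mull // mulnC.
by rewrite mulnC mulrnA md0 mul0rn.
Qed.

End CyclotomicSums.

(* [chebU (x + x^-1) n = (x^n - x^-n) / (x - x^-1)] *)
Fixpoint chebU (R : pzRingType) (s : R) (n : nat) : R :=
  match n with
  | 0 => 0
  | n'.+1 => if n' is n''.+1 then s * chebU s n' - chebU s n'' else 1
  end.

Arguments chebU : simpl never.

Lemma chebUSS (R : pzRingType) (s : R) n :
  chebU s n.+2 = s * chebU s n.+1 - chebU s n.
Proof. by []. Qed.

Lemma nat_ind2 (P : nat -> Prop) :
  P 0 -> P 1 -> (forall n, P n -> P n.+1 -> P n.+2) -> forall n, P n.
Proof.
move=> P0 P1 PSS n; suff [] : P n /\ P n.+1 by [].
by elim: n => [|n [Pn Pn1]]; split => //; apply: PSS.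
Qed.

Lemma rmorph_chebU (R S : nzRingType) (f : {rmorphism R -> S}) s n :
  f (chebU s n) = chebU (f s) n.
Proof.
elim/nat_ind2: n => [||n IH IH1]; rewrite ?rmorph0 ?rmorph1 //.
by rewrite !chebUSS rmorphB rmorphM IH IH1.
Qed.

(** * Chebyshev values as geometric sums *)

Section ChebGeom.
Variables (L : fieldType) (z : L).
Hypothesis z0 : z != 0.

(** Clearing denominators turns the closed form into a geometric sum, which stays meaningful when
    [z ^+ 2 = 1]. *)
Lemma chebU_geom n :
  chebU (z + z^-1) n * z ^+ n = z * \sum_(j < n) (z ^+ 2) ^+ j.
Proof.
elim/nat_ind2: n => [||n IH IH1].
- by rewrite big_ord0 mul0r mulr0.
- by rewrite big_ord1 mul1r mulr1.
have E : \sum_(j < n.+2) (z ^+ 2) ^+ j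
    = (z ^+ 2 + 1) * \sum_(j < n.+1) (z ^+ 2) ^+ j
      - z ^+ 2 * \sum_(j < n) (z ^+ 2) ^+ j.
  by rewrite big_ord_recr [\sum_(j < n.+1) _]big_ord_recr /= !exprS; ring.
rewrite chebUSS E.
have -> : (z + z^-1) = (z ^+ 2 + 1) / z by field.
transitivity ((z ^+ 2 + 1) * (chebU (z + z^-1) n.+1 * z ^+ n.+1)
    - z ^+ 2 * (chebU (z + z^-1) n * z ^+ n)); last by rewrite IH IH1; ring.
have -> : (z + z^-1) = (z ^+ 2 + 1) / z by field.
by rewrite !exprS; field.
Qed.

Lemma sum_expr_split n :
  \sum_(j < n.*2.+1) z ^+ j
    = \sum_(j < n.+1) (z ^+ 2) ^+ j + z * \sum_(j < n) (z ^+ 2) ^+ j.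
Proof.
elim: n => [|n IH]; first by rewrite big_ord0 mulr0 addr0 !big_ord1.
rewrite doubleS 2!big_ord_recr /= IH [X in _ = X + _]big_ord_recr /=.
rewrite [X in _ = _ + z * X]big_ord_recr /= -addnn.
by rewrite -!exprM !mul2n -!addnn !(exprS, exprD, addSn, addnS); ring.
Qed.

(** The two Chebyshev values supply the even and the odd powers of [z], which interleave into a
    single sum. *)
Lemma chebU_geom_odd n :
  (chebU (z + z^-1) n.+1 + chebU (z + z^-1) n) * z ^+ n.+1
    = z * \sum_(j < n.*2.+1) z ^+ j.
Proof.
rewrite mulrDl chebU_geom // (exprS z n) mulrCA chebU_geom //.
by rewrite sum_expr_split; ring.
Qed.

End ChebGeom.

(** At [s = z ^+ a + z ^- a] the expression is, up to a unit, a sum of [m] powers of [z ^+ a] for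
    odd [m], and of [m./2] powers of [z ^+ (a * 2)] for even [m]. Both vanish by [root_Phi_sum]. *)
Lemma fourcos2_chebU (K : fieldType) m (c : nat -> K) a :
    fourcos2 m c -> (1 <= a <= (m - 1)./2)%N ->
  if odd m then chebU (c a - 2%:R) m./2.+1 + chebU (c a - 2%:R) m./2 = 0
  else chebU (c a - 2%:R) m./2 = 0.
Proof.
case=> L [iota [z [zm cE]]] /andP[a1 am].
have mE := odd_double_half m.
have m0 : (m > 0)%N by case: (m) am => //=; rewrite leqNgt a1.
have z0 : z != 0.
  apply/eqP => z0; have := root_Phi_expr1 m0 (dvdnn m) zm.
  by rewrite z0 expr0n eqn0Ngt m0 => /esym/eqP; rewrite oner_eq0.
have za0 : z ^+ a != 0 by rewrite expf_eq0 (negPf z0) andbF.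
have sE : iota (c a - 2%:R) = z ^+ a + (z ^+ a)^-1.
  by rewrite rmorphB rmorph_nat cE addrAC (addrC 2%:R) addrK.
(* With [0 < a], this bound shows that [m] divides neither [a] nor [a.*2]. *)
have am2 : (a.*2 < m)%N.
  have : (a.*2 <= (m - 1)./2.*2)%N by rewrite leq_double.
  move/leq_ltn_trans; apply; rewrite -{2}(subnK m0) addn1 ltnS.
  by rewrite -{2}(odd_double_half (m - 1)) leq_addl.
case: ifP mE => mo mE; apply: (fmorph_inj iota); rewrite rmorph0 ?rmorphD.
  have {}mE : m./2.*2.+1 = m by [].
  apply: (mulIf (expf_neq0 m./2.+1 za0)).
  rewrite !rmorph_chebU sE chebU_geom_odd // mul0r mE.
  rewrite (root_Phi_sum (m := m)) ?mulr0 //; first by rewrite dvdn_mull.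
  by rewrite gtnNdvd // (leq_ltn_trans _ am2) // -addnn leq_addr.
apply: (mulIf (expf_neq0 m./2 za0)).
rewrite rmorph_chebU sE chebU_geom // mul0r -exprM.
rewrite (root_Phi_sum (m := m)) ?mulr0 // muln2.
  by rewrite -muln2 -mulnA mul2n -[X in (X %| _)%N]mE add0n dvdn_mull.
by rewrite gtnNdvd // double_gt0.
Qed.

(** * Alternating products of two operators *)

(** The product f g f ... of [m] factors, grouped into powers of the single operator [f \o g]; for
    odd [m] the unpaired innermost factor is [f]. *)
Definition alt_iter (T : Type) (f g : T -> T) (m : nat) (x : T) : T :=
  iter m./2 (f \o g) (iter (odd m) f x).

Section AltLinear.
Variables (K : fieldType) (V : vectType K) (f g : 'End(V)) (m : nat).

Fact iter_linear (h : V -> V) n : linear h -> linear (iter n h).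
Proof. by move=> hL; elim: n => [//|n IH] a x y; rewrite !iterS IH hL. Qed.

Fact alt_iter_linear : linear (alt_iter f g m).
Proof.
move=> a x y; rewrite /alt_iter (iter_linear _ (h := f)); last exact: linearP.
by apply: iter_linear => b u v; rewrite /= !linearP.
Qed.
HB.instance Definition _ :=
  GRing.isLinear.Build K V V _ (alt_iter f g m) alt_iter_linear.

End AltLinear.

Lemma alt_iter_eigen (K : fieldType) (V : vectType K) (f g : 'End(V)) a m x :
  f x = a *: x -> g x = a *: x -> alt_iter f g m x = a ^+ m *: x.
Proof.
move=> fx gx; rewrite /alt_iter; have -> : iter (odd m) f x = a ^+ odd m *: x.
  by case: (odd m); rewrite ?expr1 ?scale1r.
rewrite -{3}(odd_double_half m); elim: (m./2) => [|n IH]; first by rewrite addn0.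
rewrite iterS IH /= !linearZ /= gx linearZ /= fx !scalerA; congr (_ *: _).
by rewrite doubleS !addnS !exprSr.
Qed.

(** For even [m] both operators occur equally often, so distinct eigenvalues are harmless. *)
Lemma alt_iter_comm (K : fieldType) (V : vectType K) (f g : 'End(V)) a b m x :
  ~~ odd m -> f x = a *: x -> g x = b *: x ->
  alt_iter f g m x = (a * b) ^+ m./2 *: x.
Proof.
move=> mo fx gx; rewrite /alt_iter (negPf mo) /=.
elim: (m./2) => [|n IH]; first by rewrite expr0 scale1r.
rewrite iterS IH /= !linearZ /= gx linearZ /= fx !scalerA.
by rewrite exprSr !mulrA; congr (_ *: _); ring.
Qed.

(** After division by [q], the relation for [h] on [x] is the Chebyshev recurrence. *)
Lemma iter_chebU (K : fieldType) (V : vectType K) (h : 'End(V)) q s x n :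
    h (h x) = (q * s) *: h x - q ^+ 2 *: x ->
  iter n.+1 h x = q ^+ n *: (chebU s n.+1 *: h x - (q * chebU s n) *: x).
Proof.
move=> hhx; elim: n => [|n IH]; first by rewrite mulr0 scale0r subr0 !scale1r.
rewrite iterS IH linearZ linearB !linearZ /= hhx chebUSS.
rewrite !(scalerDr, scalerN, scalerA) addrAC -scalerBl.
by congr (_ *: _ - _ *: _); rewrite (exprS q n); ring.
Qed.

(** * The braid relation on the span of two vectors *)

Section RankTwo.
Variables (K : fieldType) (V : vectType K) (f g : 'End(V)) (q mu s : K) (v w : V).
Hypotheses (fv : f v = q *: v) (fw : f w = ((q + 1) * mu) *: v - w).
Hypotheses (gw : g w = q *: w) (gv : g v = (q + 1) *: w - v).
Hypothesis mus : (q + 1) ^+ 2 * mu = q * (2%:R + s).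

Let qsE : q * s = (q + 1) ^+ 2 * mu - 2%:R * q.
Proof. by rewrite mus; ring. Qed.

Let combB a b a' b' : (a *: v + b *: w) - (a' *: v + b' *: w)
  = (a - a') *: v + (b - b') *: w.
Proof. by rewrite opprD addrACA -!scalerBl. Qed.

Let combZ k a b : k *: (a *: v + b *: w) = (k * a) *: v + (k * b) *: w.
Proof. by rewrite scalerDr !scalerA. Qed.

Lemma rank2_f a b :
  f (a *: v + b *: w) = (q * a + (q + 1) * mu * b) *: v + (- b) *: w.
Proof.
rewrite linearD !linearZ /= fv fw scalerBr !scalerA scalerDl scaleNr addrA.
by congr (_ *: _ + _ *: _ - _); ring.
Qed.

Lemma rank2_g a b :
  g (a *: v + b *: w) = (- a) *: v + ((q + 1) * a + q * b) *: w.
Proof.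
rewrite linearD !linearZ /= gv gw scalerBr !scalerA scalerDl scaleNr.
rewrite [_ *: w - _]addrC -addrA; by congr (_ + (_ *: _ + _ *: _)); ring.
Qed.

(** This is Cayley-Hamilton for the formal 2 by 2 matrix of [f \o g], of trace [q * s] and
    determinant [q ^+ 2]; [v] and [w] may be linearly dependent. *)
Lemma rank2_quad_fg a b : let x := a *: v + b *: w in
  f (g (f (g x))) = (q * s) *: f (g x) - q ^+ 2 *: x.
Proof.
rewrite /= !(rank2_f, rank2_g) !(combZ, combB).
by congr (_ *: _ + _ *: _); ring: qsE.
Qed.

Lemma rank2_quad_gf a b : let x := a *: v + b *: w in
  g (f (g (f x))) = (q * s) *: g (f x) - q ^+ 2 *: x.
Proof.
rewrite /= !(rank2_f, rank2_g) !(combZ, combB).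
by congr (_ *: _ + _ *: _); ring: qsE.
Qed.

(** In the odd case this makes the difference of the two sides of the braid relation a multiple of
    [f x - g x]. *)
Lemma rank2_fgf a b : let x := a *: v + b *: w in
  f (g (f x)) - g (f (g x)) = (q * (1 + s)) *: (f x - g x).
Proof.
rewrite /= !(rank2_f, rank2_g) !(combZ, combB).
by congr (_ *: _ + _ *: _); ring: qsE.
Qed.

Lemma rank2_braid m a b : (m > 1)%N ->
    (if odd m then chebU s m./2.+1 + chebU s m./2 = 0 else chebU s m./2 = 0) ->
  alt_iter f g m (a *: v + b *: w) = alt_iter g f m (a *: v + b *: w).
Proof.
move=> m1; rewrite /alt_iter.
(* The formula of [iter_chebU] starts at the first power, hence [m > 1]. *)
case E: m./2 => [|n]; first by case: m m1 E => [|[|m]].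
have itf (x : V) : f (g (f (g x))) = (q * s) *: f (g x) - q ^+ 2 *: x ->
    iter n.+1 (f \o g) x
      = q ^+ n *: (chebU s n.+1 *: f (g x) - (q * chebU s n) *: x).
  move=> H; rewrite -(@eq_iter _ (f \o g)%VF); last by move=> y; rewrite comp_lfunE.
  by rewrite (iter_chebU (s := s) (q := q)) !comp_lfunE.
have itg (x : V) : g (f (g (f x))) = (q * s) *: g (f x) - q ^+ 2 *: x ->
    iter n.+1 (g \o f) x
      = q ^+ n *: (chebU s n.+1 *: g (f x) - (q * chebU s n) *: x).
  move=> H; rewrite -(@eq_iter _ (g \o f)%VF); last by move=> y; rewrite comp_lfunE.
  by rewrite (iter_chebU (s := s) (q := q)) !comp_lfunE.
case: (odd m) => U0.
  rewrite itf ?itg /=; last 2 first.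
  - by rewrite rank2_g rank2_quad_gf.
  - by rewrite rank2_f rank2_quad_fg.
  congr (_ *: _); apply/eqP; rewrite -subr_eq0 opprD addrACA -opprD -!scalerBr.
  rewrite rank2_fgf scalerA -scalerBl.
  rewrite (_ : _ - _ = q * (chebU s n.+2 + chebU s n.+1)).
    by rewrite U0 mulr0 scale0r.
  by rewrite chebUSS; ring.
(* For even [m] the terms in [f (g x)] and [g (f x)] vanish, which leaves the same multiple of [x]
   on both sides. *)
by rewrite itf ?itg ?rank2_quad_fg ?rank2_quad_gf // U0 !scale0r.
Qed.

End RankTwo.

(** * The universal property of the Hecke algebra *)

Section Lift.
Variables (K : fieldType) (I : finType) (M : I -> I -> nat) (q : K).
Variables (A : algType K) (s : I -> A).
Hypothesis s_quad : forall i, (s i - q *: 1) * (s i + 1) = 0.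
Hypothesis s_braid : forall i j, i != j ->
  alternate (s i) (s j) (M i j) = alternate (s j) (s i) (M i j).

Local Notation F := {malg K[{fmonom I}]}.
Local Notation X i := (<< fmu i >> : F).

Definition word_prod (m : {fmonom I}) : A := \prod_(i <- m) s i.

Fact word_prod_mmorphism : mmorphism word_prod.
Proof.
by split=> [x y|]; rewrite /word_prod ?fmM ?big_cat // fm1 big_nil.
Qed.
HB.instance Definition _ :=
  isMultiplicative.Build {fmonom I} A word_prod word_prod_mmorphism.

Definition free_lift (x : F) : A := mmap (in_alg A) word_prod x.

Lemma free_liftD x y : free_lift (x + y) = free_lift x + free_lift y.
Proof. exact: raddfD. Qed.

Lemma free_liftB x y : free_lift (x - y) = free_lift x - free_lift y.
Proof. exact: raddfB. Qed.

Lemma free_liftZ a x : free_lift (a *: x) = a *: free_lift x.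
Proof. by rewrite /free_lift mmapZ /= mulr_algl. Qed.

Lemma free_lift1 : free_lift 1 = 1.
Proof. exact: mmap1. Qed.

(** Multiplicativity into a noncommutative [A] rests on scalars being central. *)
Lemma free_liftM x y : free_lift (x * y) = free_lift x * free_lift y.
Proof.
apply: (commr_mmap_is_multiplicative (f := in_alg A) _).1 => g m m'.
by rewrite /GRing.comm /= mulr_algl mulr_algr.
Qed.

Lemma free_liftX i : free_lift (X i) = s i.
Proof. by rewrite /free_lift mmapU /= scale1r mul1r /word_prod fmuE big_seq1. Qed.

Lemma free_lift_alternate i j n :
  free_lift (alternate (X i) (X j) n) = alternate (s i) (s j) n.
Proof.
by elim: n i j => [|n IH] i j /=; rewrite ?free_lift1 // free_liftM free_liftX IH.
Qed.

Lemma free_lift_ideal x : hecke_ideal M q x -> free_lift x = 0.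
Proof.
elim=> [|a r b y hr _ IH]; first exact: raddf0.
rewrite free_liftD IH addr0 !free_liftM.
suff -> : free_lift r = 0 by rewrite mulr0 mul0r.
case: hr => [i|i j ij]; last first.
  by rewrite free_liftB !free_lift_alternate s_braid ?subrr.
by rewrite free_liftM free_liftB free_liftD free_liftZ free_lift1 free_liftX s_quad.
Qed.

Lemma hecke_alg_lift : exists rho : hecke_alg M q -> A,
  [/\ linear rho, rho 1 = 1, {morph rho : x y / x * y}
    & forall i, rho (hecke_gen M q i) = s i].
Proof.
pose rho (x : hecke_alg M q) := free_lift (repr x).
have rhoE x : rho (hecke_pi M q x) = free_lift x.
  apply/eqP; rewrite -subr_eq0 -free_liftB; apply/eqP/free_lift_ideal.
  exact/asboolP/hecke_repr_pi.
exists rho; split=> [a||x y|i].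
- elim/hecke_ind=> x; elim/hecke_ind=> y.
  by rewrite -hecke_piZ -hecke_piD !rhoE free_liftD free_liftZ.
- by rewrite [LHS]rhoE free_lift1.
- elim/hecke_ind: x => x; elim/hecke_ind: y => y.
  by rewrite -hecke_piM !rhoE free_liftM.
- by rewrite rhoE free_liftX.
Qed.

End Lift.


(** * Endomorphisms under composition as an algebra *)

Section LfunLift.
Variables (K : fieldType) (V : vectType K).
Hypothesis V_proper : (dim V > 0)%N.

Fact comp_lfun_scalel a (f g : 'End(V)) :
  a *: (f \o g)%VF = ((a *: f) \o g)%VF.
Proof. exact: comp_lfunZl. Qed.

Fact comp_lfun_scaler a (f g : 'End(V)) :
  a *: (f \o g)%VF = (f \o (a *: g))%VF.
Proof. exact: comp_lfunZr. Qed.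

Definition lfun_comp_lalgType : lalgType K :=
  HB.pack 'End(V) (lfun_comp_nzRingType V_proper)
    (GRing.Lmodule_isLalgebra.Build K (lfun_comp_nzRingType V_proper)
      comp_lfun_scalel).

Definition lfun_comp_algType : algType K :=
  HB.pack 'End(V) lfun_comp_lalgType
    (GRing.Lalgebra_isAlgebra.Build K lfun_comp_lalgType comp_lfun_scaler).

Lemma alternate_lfun (f g : lfun_comp_algType) m (x : V) :
  (alternate f g m : 'End(V)) x
    = alt_iter (f : 'End(V)) (g : 'End(V)) m x.
Proof.
elim/nat_ind2: m => [||n IH _].
- by rewrite id_lfunE.
- by rewrite /= mulr1.
by rewrite !comp_lfunE /= IH /alt_iter /= negbK.
Qed.

End LfunLift.

Lemma hecke_rep_lift (K : fieldType) (I : finType) (M : I -> I -> nat) (q : K)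
    (V : vectType K) (t : I -> 'End(V)) :
    (forall i x, t i (t i x + x) = q *: (t i x + x)) ->
    (forall i j, i != j -> forall x,
      alt_iter (t i) (t j) (M i j) x = alt_iter (t j) (t i) (M i j) x) ->
  exists rho : hecke_alg M q -> 'End(V),
    representation rho /\ forall i, rho (hecke_gen M q i) = t i.
Proof.
(* The ring structure on ['End(V)] demands [1 != 0], so the zero space is treated apart. *)
move=> t_quad t_braid; have [V0|V_proper] := posnP (dim V).
  have eqV (f g : 'End(V)) : f = g.
    apply/lfunP=> x; suff V1 (y : V) : y = 0 by rewrite [LHS]V1 [RHS]V1.
    have /eqP fV0 : (fullv : {vspace V}) == 0%VS by rewrite -dimv_eq0 dimvf V0.
    by apply/eqP; rewrite -memv0 -fV0 memvf.
  exists (fun=> 0); split=> [|i]; last exact: eqV.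
  by split=> [a u v||u v]; apply: eqV.
have [||rho [rhoL rho1 rhoM rhoX]] :=
  @hecke_alg_lift K I M q (lfun_comp_algType V_proper) t.
- move=> i; suff : ((t i - q *: \1) \o (t i + \1))%VF = 0 by [].
  apply/lfunP=> x; rewrite comp_lfunE !add_lfunE opp_lfunE scale_lfunE !id_lfunE.
  by rewrite t_quad subrr zero_lfunE.
- move=> i j ij; apply/lfunP=> x; rewrite !alternate_lfun; exact: t_braid.
by exists rho; split=> //; split.
Qed.

(** * Quadratic and braid relations for the operators [t i] *)

Section Braid.
Variables (K : fieldType) (I : finType) (M : I -> I -> nat) (q : K).
Variables (c : nat -> nat -> K) (Psi : hrep M q c).

Local Notation A := (hrep_map Psi).
Local Notation inb := (@dsum_in K I (hrep_space Psi)).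
Local Notation t := (hrep_t Psi).
Local Notation bar := (hrep_bar Psi).
Local Notation quo := (vquot_pi (hrep_rel Psi)).

(* the map [proj] local to the definition of [hrep_t] *)
Definition hrep_proj i : 'Hom(bar, hrep_space Psi i) :=
  linfun (fun u : bar => u i + \sum_(j | j != i) A j i (u j)).

Lemma hrep_projE i u : hrep_proj i u = u i + \sum_(j | j != i) A j i (u j).
Proof.
pose p := fun u : bar => u i + \sum_(j | j != i) A j i (u j).
pose pL : {linear bar -> hrep_space Psi i} :=
  HB.pack p (GRing.isLinear.Build _ _ _ _ p (@hrep_proj_linear _ _ _ _ _ Psi i)).
exact: (lfunE pL).
Qed.

Lemma hrep_projE_in i x : hrep_proj i (inb i x) = x.
Proof. by rewrite hrep_projE; apply: hrep_proj_in. Qed.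

Lemma hrep_projE_in_neq i j x : j != i -> hrep_proj i (inb j x) = A j i x.
Proof. by move=> ji; rewrite hrep_projE; apply: hrep_proj_in_neq. Qed.

Lemma hrep_tE i u : t i (quo u) = (q + 1) *: quo (inb i (hrep_proj i u)) - quo u.
Proof.
rewrite -{1}(subrKC (inb i (hrep_proj i u)) u) linearD linearD /=.
rewrite hrep_t_Vi; last by rewrite !memv_img ?memvf.
rewrite hrep_t_Vi0; last by rewrite memv_img // hrep_projE; apply: hrep_decomp.
by rewrite linearB opprB /= scalerDl scale1r addrA.
Qed.

(** By [hrep_tE], [t i x + x] lies in V_i, where [t i] acts as [q]. *)
Lemma hrep_t_quad i (x : hrep_V Psi) : t i (t i x + x) = q *: (t i x + x).
Proof.
have /memv_imgP[u _ ->] : x \in limg quo by rewrite limg_vquot_pi memvf.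
rewrite hrep_tE subrK linearZ /= hrep_t_Vi; last by rewrite !memv_img ?memvf.
by rewrite scalerA mulrC -scalerA.
Qed.

Lemma hrep_rel_eq i j x : i != j -> A j i (A i j x) = x ->
  quo (inb i x) = quo (inb j (A i j x)).
Proof.
move=> ij xij; apply/eqP; rewrite -subr_eq0 -linearB vquot_piP -hrep_diffE.
apply: subvP (memv_img _ _); first by rewrite /hrep_rel (sumv_sup j) // (sumv_sup i).
by rewrite memv_ker add_lfunE opp_lfunE comp_lfunE id_lfunE xij subrr.
Qed.

Lemma couple_braid i j (x : hrep_space Psi i) mu :
    i != j -> (M i j > 1)%N -> q != 0 -> q != -1 ->
    fourcos2 (M i j) (c (M i j)) ->
    couple_eigenvalue q (M i j) (c (M i j)) mu -> A j i (A i j x) = mu *: x ->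
  alt_iter (t i) (t j) (M i j) (quo (inb i x))
    = alt_iter (t j) (t i) (M i j) (quo (inb i x)).
Proof.
move=> ij m1 q0 qN1 fc muP xmu; have ji : j != i by rewrite eq_sym.
set v := quo _; pose w := quo (inb j (A i j x)).
have q1 : q + 1 != 0 by rewrite addr_eq0.
have tiv : t i v = q *: v.
  by rewrite hrep_tE hrep_projE_in scalerDl scale1r addrK.
have tjw : t j w = q *: w.
  by rewrite hrep_tE hrep_projE_in scalerDl scale1r addrK.
have tiw : t i w = ((q + 1) * mu) *: v - w.
  by rewrite hrep_tE hrep_projE_in_neq // xmu !linearZ /= scalerA mulrC.
have tjv : t j v = (q + 1) *: w - v by rewrite hrep_tE hrep_projE_in_neq.
case: muP => [mu1|[a [am muE]]|[mo mu0]].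
(* For eigenvalue 1, the quotient by W identifies [x] with [A i j x]. *)
- have vw : v = w by apply: hrep_rel_eq; rewrite // xmu mu1 scale1r.
  have tjv' : t j v = q *: v by rewrite vw.
  by rewrite (alt_iter_eigen _ tiv tjv') (alt_iter_eigen _ tjv' tiv).
- have := fourcos2_chebU fc am; set s := c _ a - _ => Us.
  (* The denominator in [lambda] is [(q + 1) ^+ 2 / q], nonzero as [q != -1]. *)
  have mus : (q + 1) ^+ 2 * mu = q * (2%:R + s).
    have q2 : q + q^-1 + 2%:R != 0.
      rewrite (_ : _ + _ = (q + 1) ^+ 2 / q); last by field.
      by rewrite mulf_neq0 ?invr_eq0 ?expf_neq0.
    rewrite muE /lambda /s [2%:R + _]addrC subrK.
    rewrite (_ : q + q^-1 + 2%:R = (q + 1) ^+ 2 / q); last by field.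
    by field; rewrite q0.
  have := rank2_braid tiv tiw tjw tjv mus 1 0 m1 Us.
  by rewrite scale1r scale0r addr0.
(* Eigenvalue 0 occurs only for even [m], where the couple condition forces [A i j x = 0]. *)
have w0 : w = 0.
  have [_ _ _ /(_ mo)[inj _]] := hrep_couple Psi ij.
  by rewrite /w inj ?linear0 // xmu mu0 scale0r.
have tjv' : t j v = -1 *: v by rewrite tjv w0 scaler0 sub0r scaleN1r.
by rewrite (alt_iter_comm mo tiv tjv') (alt_iter_comm mo tjv' tiv) mulrC.
Qed.

(** Both sides are linear in [x], and diagonalizability supplies a basis of eigenvectors. *)
Lemma couple_braid_all i j (x : hrep_space Psi i) :
    i != j -> (M i j > 1)%N -> q != 0 -> q != -1 ->
    fourcos2 (M i j) (c (M i j)) ->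
  alt_iter (t i) (t j) (M i j) (quo (inb i x))
    = alt_iter (t j) (t i) (M i j) (quo (inb i x)).
Proof.
move=> ij m1 q0 qN1 fc.
have [[[b bB bE] _] eigP _ _] := hrep_couple Psi ij.
rewrite (coord_basis (bB : basis_of fullv (in_tuple b)) (memvf x)).
rewrite !linear_sum /=; apply: eq_bigr => k _; rewrite !linearZ /=; congr (_ *: _).
have bk : (in_tuple b)`_k \in b by apply: mem_nth.
have [mu xmu] := bE _ bk; rewrite comp_lfunE in xmu.
apply: (couple_braid (mu := mu)) => //; apply: eigP.
apply/eqP => E; have : (in_tuple b)`_k \in (0%VS : {vspace hrep_space Psi i}).
  rewrite -E memv_ker add_lfunE opp_lfunE scale_lfunE id_lfunE comp_lfunE xmu.
  by rewrite subrr.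
have := free_not0 (basis_free bB) bk.
by rewrite memv0 => /negPf->.
Qed.

(* V = V_i + V_j + (V_i^0 \cap V_j^0), by condition (c) *)
Lemma hrep_decomp2 i j (u : bar) : i != j ->
  exists x y, exists2 u', u = inb i x + inb j y + u'
    & hrep_proj i u' = 0 /\ hrep_proj j u' = 0.
Proof.
move=> ij; have ji : j != i by rewrite eq_sym.
(* The unknowns must satisfy [x + A j i y = hrep_proj i u] and [A i j x + y = hrep_proj j u].
   Eliminating [x] leaves an equation for [y] whose solvability is this membership. *)
have : hrep_proj j u - A i j (hrep_proj i u) \in limg (\1 - (A i j \o A j i))%VF.
  rewrite [u]dsum_sumE !linear_sum -big_split /=; apply: memv_suml => k _.
  have [->|ki] := eqVneq k i.
    by rewrite hrep_projE_in hrep_projE_in_neq // subrr mem0v.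
  have [->|kj] := eqVneq k j.
    rewrite hrep_projE_in hrep_projE_in_neq //; apply/memv_imgP.
    by exists (u j); rewrite ?memvf // add_lfunE opp_lfunE comp_lfunE id_lfunE.
  rewrite !hrep_projE_in_neq //.
  rewrite eq_sym in ki; rewrite eq_sym in kj.
  (* Condition (c) enters here, for components outside [i] and [j]. *)
  apply: (subvP (hrep_img Psi ij kj ki)).
  apply/memv_imgP; exists (u k); rewrite ?memvf //.
  by rewrite add_lfunE opp_lfunE comp_lfunE.
case/memv_imgP=> y _; rewrite add_lfunE opp_lfunE comp_lfunE id_lfunE => yE.
pose x := hrep_proj i u - A j i y.
have pB k : hrep_proj k (u - (inb i x + inb j y))
    = hrep_proj k u - (hrep_proj k (inb i x) + hrep_proj k (inb j y)).
  by rewrite linearB linearD.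
exists x, y, (u - (inb i x + inb j y)); first by rewrite subrKC.
rewrite !pB !hrep_projE_in !hrep_projE_in_neq //; split.
  by rewrite /x subrK subrr.
apply/eqP; rewrite subr_eq0 /x linearB /= -addrA [_ + y]addrC -yE addrC.
by rewrite subrK.
Qed.

Lemma hrep_braid i j (z : hrep_V Psi) :
    coxeter_matrix M -> i != j -> q != 0 ->
    fourcos2 (M i j) (c (M i j)) ->
  alt_iter (t i) (t j) (M i j) z = alt_iter (t j) (t i) (M i j) z.
Proof.
move=> [_ hM] ij q0 fc; have [mij m1] := hM _ _ ij.
have ji : j != i by rewrite eq_sym.
have /memv_imgP[u _ ->] : z \in limg quo by rewrite limg_vquot_pi memvf.
have tN k u' : (q + 1) *: quo (inb k (hrep_proj k u')) = 0 ->
    t k (quo u') = -1 *: quo u'.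
  by rewrite hrep_tE => ->; rewrite sub0r scaleN1r.
(* At [q = -1] the denominator of [lambda] vanishes, but every [t k] is then -1. *)
have [qN1|qN1] := eqVneq q (-1).
  have q10 : q + 1 = 0 by rewrite qN1 addNr.
  have tNu k : t k (quo u) = -1 *: quo u by apply: tN; rewrite q10 scale0r.
  by rewrite (alt_iter_eigen _ (tNu i) (tNu j)) (alt_iter_eigen _ (tNu j) (tNu i)).
have [x [y [u' -> [u'i u'j]]]] := hrep_decomp2 u ij.
rewrite !linearD /=; congr (_ + _ + _).
- exact: couple_braid_all.
- by rewrite mij; apply/esym/couple_braid_all; rewrite -?mij.
have ti := tN i u'; have tj := tN j u'.
rewrite u'i linear0 linear0 scaler0 in ti.
rewrite u'j linear0 linear0 scaler0 in tj.
rewrite (alt_iter_eigen _ (ti erefl) (tj erefl)).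
by rewrite (alt_iter_eigen _ (tj erefl) (ti erefl)).
Qed.

End Braid.

Theorem theorem1p3 (K : fieldType) (I : finType) (M : I -> I -> nat)
    (hM : coxeter_matrix M)
    (c : nat -> nat -> K)
    (hc : forall i j : I, i != j -> fourcos2 (M i j) (c (M i j)))
    (q : K) (hq : generic M q) (Psi : hrep M q c) :
  exists rho : hecke_alg M q -> 'End(hrep_V Psi),
    representation rho /\
    forall i : I, rho (hecke_gen M q i) = hrep_t Psi i.
Proof.
have [q0 _] := hq; apply: hecke_rep_lift => [i x|i j ij x].
  exact: hrep_t_quad.
by apply: hrep_braid => //; apply: hc.
Qed.
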